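(* Let $n\ge k\ge 2$ be integers. If $G$ is a graph of order $n$ with adjacency matrix $A$, then $$\|G\|_{[k]}\le \frac{n\sqrt k}{2}+\frac n2 .$$ Equality holds if and only if $2A-J_n$ is a regular, symmetric $(-1,1)$-matrix, with $-1$ along the diagonal, with row sums equal to $n/\sqrt k$, and with exactly $k$ nonzero singular values, which are all equal to $n/\sqrt k$.
   Context: Graphs are finite, simple and undirected. For a graph $G$ of order $n$ with adjacency matrix $A$, $\|G\|_{[k]}:=\|A\|_{[k]}=\sigma_1(A)+\cdots+\sigma_k(A)$ is the Ky Fan $k$-norm, where $\sigma_1(A)\ge\cdots\ge\sigma_n(A)$ are the singular values of $A$. $J_n$ is the $n\times n$ all-ones matrix. A $(-1,1)$-matrix is a matrix all of whose entries are $-1$ or $1$. A matrix is called regular if all its row sums are equal and all its column sums are equal. *)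

(* Defs.v *)
From HB Require Import structures.
From mathcomp Require Import all_boot all_order all_algebra.
From mathcomp Require Import polyrcf.

Set Implicit Arguments.
Unset Strict Implicit.
Unset Printing Implicit Defensive.

Import Order.TTheory GRing.Theory Num.Theory.
Local Open Scope ring_scope.

Record simple_graph (n : nat) := SimpleGraph {
  adj : rel 'I_n;
  adj_sym : symmetric adj;
  adj_irr : irreflexive adj
}.

Definition adjmx (R : pzRingType) (n : nat) (G : simple_graph n) : 'M[R]_n :=
  \matrix_(i, j) (adj G i j)%:R.

(* [rootsR] lists every root once, so each root is repeated [mup] times. *)
Definition real_eigenvalues (R : rcfType) (n : nat) (M : 'M[R]_n) : seq R :=
  flatten [seq nseq (mup x (char_poly M)) x | x <- rootsR (char_poly M)].

(* The eigenvalues of M^T M are all real and nonnegative, so for an n x n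
   matrix this list has n entries. *)
Definition singular_values (R : rcfType) (n : nat) (M : 'M[R]_n) : seq R :=
  sort >=%R [seq Num.sqrt x | x <- real_eigenvalues (M^T *m M)].

(* Entries are indexed from 0: sigma_(i+1)(M) is (singular_values M)`_i. *)
Definition kyfan_norm (R : rcfType) (k n : nat) (M : 'M[R]_n) : R :=
  \sum_(i < k) (singular_values M)`_i.

Definition graph_kyfan_norm (R : rcfType) (k n : nat) (G : simple_graph n) : R :=
  kyfan_norm k (adjmx R G).

Definition pm1_mx (R : pzRingType) (m n : nat) (M : 'M[R]_(m, n)) : Prop :=
  forall i j, M i j = -1 \/ M i j = 1.

Definition row_sum (R : pzRingType) (m n : nat) (M : 'M[R]_(m, n)) (i : 'I_m) : R :=
  \sum_j M i j.

Definition col_sum (R : pzRingType) (m n : nat) (M : 'M[R]_(m, n)) (j : 'I_n) : R :=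
  \sum_i M i j.

Definition regular_mx (R : pzRingType) (m n : nat) (M : 'M[R]_(m, n)) : Prop :=
  (forall i i', row_sum M i = row_sum M i') /\
  (forall j j', col_sum M j = col_sum M j').

(* Main.v *)
Require Import Defs.
From HB Require Import structures.
From mathcomp Require Import all_boot all_order all_algebra.
From mathcomp Require Import polyrcf complex.
From mathcomp Require Import ring lra.

(** Write [H] for [2A - J].  It is a symmetric sign matrix, so its Frobenius norm
    is [n], and [2A = H + J].  Call [W] a partial reflection of rank [k] if it is
    symmetric with [k] eigenvalues equal to [1] or [-1] and the others equal to
    [0].  For symmetric [M], the Ky Fan norm [kyfan_norm k M] is the maximum of
    [\tr (M *m W)] over these [W] ([kyfan_norm_attained], [kyfan_norm_ge]).

    Upper bound.  Choose [W] attaining the norm of [A].  Then twice the norm is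
    [\tr (H *m W) + \tr (J *m W)].  The first term is at most [n * sqrt k] by
    Cauchy-Schwarz ([frobenius_cauchy_schwarz]), because the Frobenius norm of [W]
    is [sqrt k]; the second is the quadratic form of [W] at the all-ones vector,
    which is at most the squared length [n] of that vector
    ([partial_reflection_form]).

    Equality forces equality in both estimates.  With [s = n / sqrt k], the first
    gives [H = s *: W], whose nonzero singular values are [k] copies of [s]; the
    second says that [W], hence [H / s], fixes the all-ones vector, so all row
    sums of [H] are [s].  Conversely, if [H] has the stated spectrum, then
    [W = H / s] is a partial reflection ([flat_singular_valuesP]); if moreover [H]
    has row sums [s], then [W] turns both estimates into equalities, so
    [\tr (A *m W)] equals the bound, and the norm is at least this trace.

    The eigenvalue decompositions come from the real spectral theorem over a real
    closed field, [symmetric_spectral_theorem]. *)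

Set Implicit Arguments.
Unset Strict Implicit.
Unset Printing Implicit Defensive.

Import Order.TTheory GRing.Theory Num.Theory.
Local Open Scope ring_scope.

(** * The Frobenius inner product *)

Lemma mxtrace_mul_trE (R : comPzRingType) m n (A B : 'M[R]_(m, n)) :
  \tr (A *m B^T) = \sum_i \sum_j A i j * B i j.
Proof.
by apply: eq_bigr => i _; rewrite mxE; apply: eq_bigr => j _; rewrite mxE.
Qed.

Lemma frobenius_ge0 (R : realDomainType) m n (A : 'M[R]_(m, n)) :
  0 <= \tr (A *m A^T).
Proof.
rewrite mxtrace_mul_trE; apply: sumr_ge0 => i _; apply: sumr_ge0 => j _.
by rewrite -expr2 sqr_ge0.
Qed.

Lemma frobenius_eq0 (R : realDomainType) m n (A : 'M[R]_(m, n)) :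
  \tr (A *m A^T) = 0 -> A = 0.
Proof.
rewrite mxtrace_mul_trE pair_bigA /= => /eqP.
rewrite psumr_eq0 => [/allP A0|p _]; last by rewrite -expr2 sqr_ge0.
apply/matrixP => i j; rewrite mxE.
by have /= := A0 (i, j) (mem_index_enum _); rewrite mulf_eq0 orbb => /eqP.
Qed.

(** Both claims come from expanding the squared norm of [X - s *: W], which is a
    positive multiple of the gap in the inequality. *)
Lemma frobenius_cauchy_schwarz (R : realFieldType) m n (X W : 'M[R]_(m, n)) (s : R) :
  0 < s -> \tr (X *m X^T) = s ^+ 2 * \tr (W *m W^T) ->
  \tr (X *m W^T) <= s * \tr (W *m W^T) /\
  (\tr (X *m W^T) = s * \tr (W *m W^T) -> X = s *: W).
Proof.
move=> s0 XX.
have gapE : \tr ((X - s *: W) *m (X - s *: W)^T) =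
    2 * s * (s * \tr (W *m W^T) - \tr (X *m W^T)).
  have WX : \tr (W *m X^T) = \tr (X *m W^T).
    by rewrite -mxtrace_tr trmx_mul trmxK.
  have -> : (X - s *: W)^T = X^T - s *: W^T by rewrite linearB linearZ.
  rewrite mulmxBl !mulmxBr -!scalemxAl -!scalemxAr.
  rewrite !(raddfB, mxtraceZ) /= !mxtraceZ WX XX; ring.
split.
  have := frobenius_ge0 (X - s *: W); rewrite gapE.
  by rewrite pmulr_rge0 ?subr_ge0 // mulr_gt0.
move=> XW; apply/eqP; rewrite -subr_eq0; apply/eqP/frobenius_eq0.
by rewrite gapE XW subrr mulr0.
Qed.

(** * The spectral theorem for real symmetric matrices *)

(** The Householder reflection that swaps [v] with the first basis vector [e] has
    [v] as its first row; it is [1 - (2 / (w *m w^T)) w^T w] with [w = v - e],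
    and the identity matrix when [v = e]. *)
Lemma unit_row_orthogonal (R : realFieldType) n (v : 'rV[R]_n.+1) :
  v *m v^T = 1%:M -> exists2 Q : 'M[R]_n.+1, Q *m Q^T = 1%:M & row 0 Q = v.
Proof.
move=> v1; have [->|neq] := eqVneq v (delta_mx 0 0).
  by exists 1%:M; rewrite ?trmx1 ?mulmx1 // rowE mulmx1.
pose e : 'rV[R]_n.+1 := delta_mx 0 0; pose w := v - e.
pose c := (w *m w^T) 0 0.
have ww : w *m w^T = c%:M by exact: mx11_scalar.
have cN0 : c != 0.
  apply/eqP => c0; move: neq; rewrite -subr_eq0 => /eqP; apply.
  by apply: frobenius_eq0; rewrite ww c0 -scalemx1 scale0r linear0.
have ev : e *m v^T = (v 0 0)%:M.
  by rewrite -rowE [LHS]mx11_scalar !mxE.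
have ee : e *m e^T = 1%:M.
  by rewrite -rowE [LHS]mx11_scalar !mxE eqxx.
have cE : c = 2 - 2 * v 0 0.
  rewrite /c /w linearB /= mulmxBl !mulmxBr v1 ev ee.
  rewrite -[v *m e^T]trmxK trmx_mul trmxK ev !mxE eqxx /=; ring.
have ew : e *m w^T = (- (c / 2))%:M.
  rewrite /w linearB /= mulmxBr ev ee -raddfB cE; congr _%:M; by field.
pose Q : 'M[R]_n.+1 := 1%:M - (2 / c) *: (w^T *m w).
exists Q.
  have sym : Q^T = Q by rewrite /Q linearB linearZ /= trmx1 trmx_mul trmxK.
  have pp : (w^T *m w) *m (w^T *m w) = c *: (w^T *m w).
    by rewrite mulmxA -(mulmxA w^T) ww mul_mx_scalar scalemxAl.
  rewrite sym {sym}/Q; move: (w^T *m w) pp => p pp.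
  rewrite mulmxBl !mulmxBr !mul1mx mulmx1 -scalemxAl -scalemxAr pp.
  rewrite !scalerA.
  have -> : 2 / c * (2 / c) * c = 2 / c + 2 / c by field.
  by rewrite scalerDl opprB addrK subrK.
rewrite rowE /Q mulmxBr mulmx1 -scalemxAr mulmxA ew mul_scalar_mx scalerA.
have -> : 2 / c * - (c / 2) = -1 by field; rewrite cN0.
by rewrite scaleN1r opprK addrC subrK.
Qed.

(** An eigenvalue exists over [R[i]], where a real symmetric matrix is Hermitian;
    so that eigenvalue is real, hence a root of the characteristic polynomial over
    [R], where it has a real eigenvector. *)
Lemma symmetric_unit_eigenvector (R : rcfType) n (S : 'M[R]_n.+1) :
  S^T = S ->
  exists (a : R) (v : 'rV[R]_n.+1), v *m v^T = 1%:M /\ v *m S = a *: v.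
Proof.
move=> symS; pose C := R[i]; pose toC := real_complex R.
pose SC : 'M[C]_n.+1 := map_mx toC S.
have hermS : SC \is hermsymmx.
  apply: realsym_hermsym.
    rewrite is_hermitianmxE expr0 scale1r map_mx_id //.
    by apply/eqP/matrixP => i j; rewrite !mxE -{1}symS mxE.
  by apply/mxOverP => i j; rewrite mxE complex_real.
pose P := spectralmx SC; pose d := spectral_diag SC.
have SP : P *m SC = diag_mx d *m P.
  have /orthomx_spectralP {1}-> := hermitian_normalmx hermS.
  by rewrite !mulmxA mulmxV ?spectral_unit // mul1mx.
have eigd : eigenvalue SC (d 0 0).
  apply/eigenvalueP; exists (row 0 P).
    by rewrite -row_mul SP row_mul row_diag_mx -scalemxAl -rowE.
  apply/eqP=> P0; have := spectral_unit SC; rewrite -row_free_unit -/P.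
  move/row_freeP => [B PB]; have := congr1 (row 0) PB.
  rewrite row_mul P0 mul0mx => /matrixP/(_ 0 0)/eqP.
  by rewrite !mxE eqxx eq_sym oner_eq0.
have /mxOverP/(_ 0 0) := hermitian_spectral_diag_real hermS.
rewrite -/d => /complex_realP[a da].
have /eigenvalueP[v va vN0] : eigenvalue S a.
  rewrite eigenvalue_root_char -(fmorph_root toC) map_char_poly.
  by move: eigd; rewrite eigenvalue_root_char da.
pose c := (v *m v^T) 0 0.
have vv : v *m v^T = c%:M by exact: mx11_scalar.
have c_gt0 : 0 < c.
  rewrite lt_def -[c](trace_mx11 (v *m v^T)) frobenius_ge0 andbT.
  by apply: contra vN0 => /eqP/frobenius_eq0 ->.
exists a, ((Num.sqrt c)^-1 *: v); split; last first.
  by rewrite -scalemxAl va !scalerA mulrC.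
rewrite linearZ /= -scalemxAl -scalemxAr vv scalerA -invfM -expr2.
by rewrite sqr_sqrtr ?ltW // scale_scalar_mx mulVf ?gt_eqF.
Qed.

(** Deflation: in an orthonormal basis whose first vector is an eigenvector, the
    matrix is block diagonal by symmetry, and the lower block is smaller. *)
Theorem symmetric_spectral_theorem (R : rcfType) n (S : 'M[R]_n) : S^T = S ->
  exists (P : 'M[R]_n) (d : 'rV[R]_n),
    P *m P^T = 1%:M /\ S = P^T *m diag_mx d *m P.
Proof.
elim: n S => [|n IHn] S symS.
  by exists 1%:M, 0; split; apply/matrixP => -[].
have [a [v [v1 vS]]] := symmetric_unit_eigenvector symS.
have [Q QQ Qv] := unit_row_orthogonal v1.
have QtQ : Q^T *m Q = 1%:M by exact: mulmx1C.
pose T : 'M[R]_(1 + n) := Q *m S *m Q^T.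
have symT : T^T = T by rewrite /T !trmx_mul trmxK symS mulmxA.
have rowT : row 0 T = a *: delta_mx 0 0.
  rewrite /T -mulmxA row_mul Qv mulmxA vS -scalemxAl -Qv -row_mul QQ.
  by rewrite rowE mulmx1.
have TE : T = block_mx a%:M 0 0 (drsubmx T).
  rewrite -[LHS]submxK; congr block_mx.
  - rewrite [LHS]mx11_scalar; congr _%:M; move/rowP/(_ 0): rowT.
    by rewrite !mxE eqxx mulr1 !lshift0.
  - apply/matrixP => i j; move/rowP/(_ (rshift 1 j)): rowT.
    by rewrite !mxE !ord1 lshift0 /= mulr0.
  - apply/matrixP => i j; move/rowP/(_ (rshift 1 i)): rowT.
    by rewrite -[in X in X -> _]symT !mxE !ord1 lshift0 /= mulr0.
have [P [d [PP dE]]] : exists (P : 'M[R]_n) (d : 'rV[R]_n), P *m P^T = 1%:M /\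
    drsubmx T = P^T *m diag_mx d *m P.
  by apply: IHn; rewrite trmx_drsub symT.
pose B : 'M[R]_(1 + n) := block_mx 1%:M 0 0 P.
have BB : B *m B^T = 1%:M.
  rewrite /B tr_block_mx mulmx_block !trmx0 !(mul0mx, mulmx0, addr0, add0r).
  by rewrite trmx1 mulmx1 PP -scalar_mx_block.
have BT : B^T *m diag_mx (row_mx a%:M d) *m B = T.
  rewrite TE dE /B diag_mx_row tr_block_mx !mulmx_block.
  rewrite !trmx0 !(mul0mx, mulmx0, addr0, add0r) trmx1 mulmx1 mul1mx.
  by congr block_mx; rewrite [LHS]mx11_scalar !mxE eqxx.
exists (B *m Q), (row_mx a%:M d); split.
  by rewrite trmx_mul mulmxA -(mulmxA B) QQ mulmx1 BB.
rewrite trmx_mul !mulmxA -(mulmxA _ B^T) -(mulmxA _ _ B) BT.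
by rewrite /T !mulmxA QtQ mul1mx -mulmxA QtQ mulmx1.
Qed.

(** * Singular values of a diagonalized symmetric matrix *)

Lemma char_poly_orthogonal_diag (R : rcfType) n (P : 'M[R]_n) (d : 'rV[R]_n) :
  P *m P^T = 1%:M ->
  char_poly (P^T *m diag_mx d *m P) =
    \prod_(x <- [seq d 0 i | i <- enum 'I_n]) ('X - x%:P).
Proof.
move=> PP; have PtP : P^T *m P = 1%:M by exact: mulmx1C.
pose Q := map_mx polyC P.
have QtQ : Q^T *m Q = 1%:M by rewrite map_trmx -map_mxM PtP map_mx1.
rewrite big_map big_enum /=.
have -> : char_poly (P^T *m diag_mx d *m P) = char_poly (diag_mx d).
  rewrite /char_poly /char_poly_mx !map_mxM /= -map_trmx -/Q.
  have -> : 'X%:M - Q^T *m map_mx polyC (diag_mx d) *m Q =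
     Q^T *m ('X%:M - map_mx polyC (diag_mx d)) *m Q.
    rewrite mulmxBr mulmxBl mul_mx_scalar -scalemxAl QtQ.
    by rewrite scalemx1.
  by rewrite !det_mulmx mulrAC -det_mulmx QtQ det1 mul1r.
rewrite char_poly_trig ?diag_mx_is_trig //.
by apply: eq_bigr => i _; rewrite mxE eqxx.
Qed.

(** Each element of [s] occurs in [s] as often as its multiplicity as a root of
    the product. *)
Lemma flatten_roots_prod (R : rcfType) (s : seq R) (p : {poly R}) :
  p = \prod_(x <- s) ('X - x%:P) ->
  perm_eq (flatten [seq nseq (mup x p) x | x <- rootsR p]) s.
Proof.
move=> pE; have pN0 : p != 0 by rewrite pE monic_neq0 // monic_prod_XsubC.
apply/allP => x _ /=; rewrite -[X in _ == X]mu_prod_XsubC -pE.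
rewrite count_flatten -map_comp sumnE big_map; apply/eqP.
have rE : (x \in rootsR p) = root p x.
  by have := roots_on_rootsR pN0 x; rewrite in_itv.
have out y : y != x -> count (pred1 x) (nseq (mup y p) y) = 0%N.
  by move=> /negPf yx; rewrite count_nseq /= yx.
have [rx|Nrx] := boolP (root p x).
  rewrite (bigD1_seq x) ?rE ?uniq_roots //= big1 ?addn0 => [|y /out //].
  by rewrite count_nseq /= eqxx mul1n.
rewrite big_seq big1 ?mupNroot // => y yr /=; apply: out.
by apply: contraNneq Nrx => yx; rewrite -rE -yx.
Qed.

(** The Gram matrix of [P^T diag(d) P] is [P^T diag(d^2) P], and [sqrt (d^2)] is
    the absolute value. *)
Lemma singular_values_diag (R : rcfType) n (P : 'M[R]_n) (d : 'rV[R]_n) :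
  P *m P^T = 1%:M ->
  perm_eq (singular_values (P^T *m diag_mx d *m P))
          [seq `|d 0 i| | i <- enum 'I_n].
Proof.
move=> PP; rewrite /singular_values perm_sort /real_eigenvalues.
pose d2 : 'rV[R]_n := \row_i d 0 i ^+ 2.
have -> : (P^T *m diag_mx d *m P)^T *m (P^T *m diag_mx d *m P) =
    P^T *m diag_mx d2 *m P.
  rewrite !trmx_mul trmxK tr_diag_mx -!mulmxA (mulmxA P) PP mul1mx.
  (* The two diagonals agree by conversion: [x ^+ 2] unfolds to [x * x]. *)
  by rewrite (mulmxA (diag_mx d)) mulmx_diag; congr (_ *m (diag_mx _ *m _)).
have -> : [seq `|d 0 i| | i <- enum 'I_n] =
    [seq Num.sqrt x | x <- [seq d2 0 i | i <- enum 'I_n]].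
  by rewrite -map_comp; apply: eq_map => i; rewrite /= mxE sqrtr_sqr.
exact/perm_map/flatten_roots_prod/char_poly_orthogonal_diag.
Qed.

(** * Sums of the largest entries *)

(** Turns a sum over the first positions of a sorted list into a sum over a set of
    indices, which can be compared with weighted sums over all indices. *)
Lemma sum_top (R : realDomainType) n k (f : 'I_n -> R) (s : seq R) :
  (k <= n)%N -> sorted >=%R s -> perm_eq s [seq f i | i <- enum 'I_n] ->
  exists I : {set 'I_n}, [/\ #|I| = k, \sum_(i < k) s`_i = \sum_(i in I) f i
    & forall i j, i \in I -> j \notin I -> f j <= f i].
Proof.
move=> kn ss sf.
pose e := sort (relpre f >=%R) (enum 'I_n).
have sE : s = map f e.
  apply: (sorted_eq ge_trans ge_anti) => //.
    by rewrite sorted_map sort_sorted // => i j /=; exact: ge_total.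
  by rewrite (permPl sf) perm_map // perm_sym perm_sort.
have size_e : size e = n by rewrite size_sort size_enum_ord.
have ue : uniq e by rewrite sort_uniq enum_uniq.
have me i : i \in e by rewrite mem_sort mem_enum.
exists [set i in take k e]; split.
- by rewrite cardsE (card_uniqP _) ?take_uniq // size_takel ?size_e.
- rewrite (eq_bigl (mem (take k e))) => [|i]; last by rewrite inE.
  rewrite -big_uniq ?take_uniq //= sE -[in RHS](big_map f xpredT id).
  rewrite map_take (big_nth 0) big_mkord size_takel ?size_map ?size_e //.
  by apply: eq_bigr => i _; rewrite nth_take.
move=> i j; rewrite !inE => iI jI.
have jD : j \in drop k e.
  by have := me j; rewrite -{1}(cat_take_drop k e) mem_cat (negPf jI).
have := ss; rewrite sE sorted_map sorted_pairwise; last first.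
  by move=> ? ? ? /=; exact: ge_trans.
rewrite -{1}(cat_take_drop k e) pairwise_cat => /andP[/allrelP le_e _].
exact: le_e iI jD.
Qed.

(** Subtracting a threshold [t] between the values inside and outside [I] changes
    both sides by the same amount, as the weights add up to [#|I|]; then the
    comparison holds term by term. *)
Lemma sum_weight_le_top (R : realFieldType) n (f m : 'I_n -> R) (I : {set 'I_n}) :
  (forall i j, i \in I -> j \notin I -> f j <= f i) ->
  (forall i, 0 <= m i <= 1) -> \sum_i m i = #|I|%:R ->
  \sum_i f i * m i <= \sum_(i in I) f i.
Proof.
move=> topI m01 sum_m; have [I0|[i0 i0I]] := set_0Vmem I.
  rewrite {}I0 cards0 in sum_m *; rewrite big_set0 big1 // => i _.
  move/eqP: sum_m; rewrite psumr_eq0 => [/allP/(_ i (mem_index_enum _))|j _].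
    by move/eqP->; rewrite mulr0.
  by case/andP: (m01 j).
pose t := f [arg min_(i < i0 in I) f i]%O.
have tI i : i \in I -> t <= f i.
  by move=> iI; rewrite /t; case: arg_minP => // j jI; apply.
have tNI i : i \notin I -> f i <= t.
  by move=> iI; rewrite /t; case: arg_minP => // j jI _; apply: topI.
rewrite -subr_ge0.
have cardI : \sum_i (i \in I)%:R = #|I|%:R :> R.
  by rewrite -natr_sum -big_mkcond /= sum1_card.
have -> : \sum_(i in I) f i - \sum_i f i * m i =
    \sum_i (f i - t) * ((i \in I)%:R - m i).
  transitivity (\sum_i (f i * (i \in I)%:R - f i * m i
                        - t * (i \in I)%:R + t * m i)); last first.
    by apply: eq_bigr => i _; ring.
  rewrite big_split sumrB sumrB /= -!mulr_sumr sum_m.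
  rewrite cardI addrNK big_mkcond; congr (_ - _).
  by apply: eq_bigr => i _; case: (i \in I); rewrite ?mulr1 ?mulr0.
apply: sumr_ge0 => i _; have /andP[m0 m1] := m01 i.
have [iI|iI] := boolP (i \in I).
  by rewrite mulr_ge0 ?subr_ge0 ?tI.
by rewrite sub0r mulr_le0 ?oppr_le0 ?subr_le0 ?tNI.
Qed.

(** * Partial reflections and the Ky Fan norm *)

(** The [W] with [W^T = W], [W^3 = W] and rank [k], presented by an eigenbasis.
    The set [I] is the support of the spectrum [e], whose values are [-1, 0, 1]. *)
Definition partial_reflection (R : numDomainType) n k (W : 'M[R]_n) : Prop :=
  exists (P : 'M[R]_n) (e : 'rV[R]_n) (I : {set 'I_n}),
    [/\ P *m P^T = 1%:M, #|I| = k, forall i, `|e 0 i| = (i \in I)%:R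
      & W = P^T *m diag_mx e *m P].

Lemma mxtrace_mul_diag (R : comPzRingType) n (M P : 'M[R]_n) (d : 'rV[R]_n) :
  \tr (M *m (P^T *m diag_mx d *m P)) = \sum_i d 0 i * (P *m M *m P^T) i i.
Proof.
rewrite mulmxA mxtrace_mulC !mulmxA.
by apply: eq_bigr => i _; rewrite mul_mx_diag mxE mulrC.
Qed.

Lemma orthogonal_diag_sym (R : comPzRingType) n (P : 'M[R]_n) (d : 'rV[R]_n) :
  (P^T *m diag_mx d *m P)^T = P^T *m diag_mx d *m P.
Proof. by rewrite !trmx_mul trmxK tr_diag_mx mulmxA. Qed.

Lemma orthogonal_diagK (R : comPzRingType) n (P : 'M[R]_n) (d : 'rV[R]_n) :
  P *m P^T = 1%:M -> P *m (P^T *m diag_mx d *m P) *m P^T = diag_mx d.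
Proof. by move=> PP; rewrite !mulmxA PP mul1mx -mulmxA PP mulmx1. Qed.

Lemma partial_reflection_sym (R : rcfType) n k (W : 'M[R]_n) :
  partial_reflection k W -> W^T = W.
Proof. by move=> [P [e [I [_ _ _ ->]]]]; exact: orthogonal_diag_sym. Qed.

Lemma partial_reflection_frobenius (R : rcfType) n k (W : 'M[R]_n) :
  partial_reflection k W -> \tr (W *m W^T) = k%:R.
Proof.
move=> WP; rewrite (partial_reflection_sym WP).
case: WP => P [e [I [PP cardI eI ->]]].
rewrite mxtrace_mul_diag orthogonal_diagK // -cardI -sum1_card natr_sum.
rewrite [RHS]big_mkcond; apply: eq_bigr => i _.
rewrite mxE eqxx mulr1n -expr2 -real_normK ?num_real // eI.
by case: (i \in I); rewrite ?expr1n ?expr0n.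
Qed.

Lemma mxtrace_row_form (R : comPzRingType) n (u : 'rV[R]_n) (M : 'M[R]_n) :
  \tr (u^T *m u *m M) = (u *m M *m u^T) 0 0.
Proof. by rewrite mxtrace_mulC mulmxA mxtrace_mulC mulmxA trace_mx11. Qed.

(** In the eigenbasis, with [t] the coordinates of [u], the gap is the sum of the
    nonnegative terms [(1 - e_i) * t_i^2].  If they all vanish, [u] has components
    only along eigenvectors with eigenvalue [1]. *)
Lemma partial_reflection_form (R : rcfType) n k (W : 'M[R]_n) (u : 'rV[R]_n) :
  partial_reflection k W ->
  (u *m W *m u^T) 0 0 <= (u *m u^T) 0 0 /\
  ((u *m W *m u^T) 0 0 = (u *m u^T) 0 0 -> u *m W = u).
Proof.
move=> [P [e [I [PP _ eI ->]]]]; have PtP : P^T *m P = 1%:M by exact: mulmx1C.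
pose t := u *m P^T.
have uE : u = t *m P by rewrite /t -mulmxA PtP mulmx1.
have gapE : (u *m u^T) 0 0 - (u *m (P^T *m diag_mx e *m P) *m u^T) 0 0 =
    \sum_i (1 - e 0 i) * t 0 i ^+ 2.
  have -> : u *m u^T = t *m t^T.
    by rewrite {1 2}uE trmx_mul mulmxA -(mulmxA t) PP mulmx1.
  have -> : u *m (P^T *m diag_mx e *m P) *m u^T = t *m diag_mx e *m t^T.
    by rewrite /t trmx_mul trmxK !mulmxA.
  rewrite [X in X - _]mxE [X in _ - X]mxE -sumrB; apply: eq_bigr => i _.
  rewrite mul_mx_diag !mxE; ring.
have gap_ge0 i : 0 <= (1 - e 0 i) * t 0 i ^+ 2.
  rewrite mulr_ge0 ?sqr_ge0 // subr_ge0 (le_trans (ler_norm _)) // eI.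
  by case: (i \in I).
split; first by rewrite -subr_ge0 gapE sumr_ge0.
move/eqP; rewrite eq_sym -subr_eq0 gapE psumr_eq0 // => /allP te.
rewrite !mulmxA -/t [RHS]uE; congr (_ *m _); apply/rowP => i.
have /= := te i (mem_index_enum _).
rewrite mul_mx_diag [in X in _ -> X = _]mxE mulf_eq0 subr_eq0 sqrf_eq0 => /orP[]/eqP.
  by move=> <-; rewrite mulr1.
by move=> ->; rewrite mul0r.
Qed.

(** [W] has the eigenvectors of [M] with the [k] largest absolute eigenvalues, and
    the signs of these eigenvalues. *)
Lemma kyfan_norm_attained (R : rcfType) n k (M : 'M[R]_n) :
  M^T = M -> (k <= n)%N ->
  exists2 W, partial_reflection k W & \tr (M *m W) = kyfan_norm k M.
Proof.
move=> /symmetric_spectral_theorem[P [a [PP ME]]] kn.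
have svM := singular_values_diag a PP; rewrite -ME in svM.
have [|I [cardI sumI _]] := sum_top kn _ svM.
  by rewrite sort_sorted // => x y; exact: ge_total.
(* A zero eigenvalue in [I] gets the sign [1], so that the rank is exactly [k]. *)
pose e : 'rV[R]_n := \row_i (if i \in I then (-1) ^+ (a 0 i < 0)%R else 0).
exists (P^T *m diag_mx e *m P).
  exists P, e, I; split => // i; rewrite mxE.
  by case: ifP; rewrite ?normr0 // normrX normrN1 expr1n.
rewrite mxtrace_mul_diag ME orthogonal_diagK // /kyfan_norm -ME sumI.
rewrite [RHS]big_mkcond; apply: eq_bigr => i _; rewrite !mxE eqxx mulr1n.
by case: ifP; rewrite ?mul0r // normrEsign ?num_real.
Qed.

(** Ky Fan's maximum principle.  In the eigenbasis of [M] the trace is a sum of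
    [a_i * w_i] with [w_i] the diagonal of [W].  With [O] the orthogonal change of
    basis, [w_i] is bounded by [m_i = \sum_j O_ij^2 |e_j|]; these weights lie in
    [[0, 1]] and add up to [k]. *)
Lemma kyfan_norm_ge (R : rcfType) n k (M W : 'M[R]_n) :
  M^T = M -> (k <= n)%N ->
  partial_reflection k W -> \tr (M *m W) <= kyfan_norm k M.
Proof.
move=> /symmetric_spectral_theorem[P [a [PP ME]]] kn [Q [e [J [QQ cardJ eJ WE]]]].
have svM := singular_values_diag a PP; rewrite -ME in svM.
have [|I [cardI sumI topI]] := sum_top kn _ svM.
  by rewrite sort_sorted // => x y; exact: ge_total.
pose O := P *m Q^T.
have OO : O *m O^T = 1%:M.
  rewrite /O trmx_mul trmxK mulmxA -(mulmxA P) (mulmx1C QQ) mulmx1; exact: PP.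
have OtO : O^T *m O = 1%:M by exact: mulmx1C.
pose m i := \sum_j O i j ^+ 2 * `|e 0 j|.
rewrite mxtrace_mulC ME mxtrace_mul_diag /kyfan_norm -ME sumI.
apply: (@le_trans _ _ (\sum_i `|a 0 i| * m i)); last first.
  apply: sum_weight_le_top => // [i|].
    apply/andP; split.
      by apply: sumr_ge0 => j _; rewrite mulr_ge0 ?sqr_ge0.
    have <- : (O *m O^T) i i = 1 by rewrite OO mxE eqxx.
    rewrite mxE; apply: ler_sum => j _; rewrite [O^T _ _]mxE -expr2.
    rewrite ler_piMr ?sqr_ge0 //.
    by rewrite eJ; case: (j \in J).
  rewrite exchange_big cardI -cardJ -sum1_card natr_sum [RHS]big_mkcond /=.
  apply: eq_bigr => j _; rewrite -mulr_suml eJ.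
  have -> : \sum_i O i j ^+ 2 = (O^T *m O) j j.
    by rewrite mxE; apply: eq_bigr => i _; rewrite [O^T _ _]mxE expr2.
  by rewrite OtO mxE eqxx mul1r; case: (j \in J).
apply: ler_sum => i _; apply: le_trans (ler_norm _) _; rewrite normrM.
apply: ler_wpM2l; first exact: normr_ge0.
have -> : P *m W *m P^T = O *m diag_mx e *m O^T.
  by rewrite WE /O trmx_mul trmxK !mulmxA.
rewrite mxE; apply: le_trans (ler_norm_sum _ _ _) _; apply: ler_sum => j _.
rewrite mul_mx_diag [O^T _ _]mxE [X in `|X * _|]mxE mulrAC normrM.
by rewrite -expr2 ger0_norm ?sqr_ge0.
Qed.

(** Allows the condition on the list of singular values to be exchanged for a
    matrix that can be tested against the Ky Fan norm. *)
Lemma flat_singular_valuesP (R : rcfType) n k (M : 'M[R]_n) (s : R) :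
  0 < s -> M^T = M ->
  (count (fun x => x != 0) (singular_values M) = k /\
   (forall x, x \in singular_values M -> x != 0 -> x = s)) <->
  partial_reflection k (s^-1 *: M).
Proof.
move=> s0 symM; have sN0 : s != 0 by rewrite gt_eqF.
have countE (a : 'rV[R]_n) :
    count (fun x => x != 0) [seq `|a 0 i| | i <- enum 'I_n]
    = #|[set i | a 0 i != 0]|.
  rewrite count_map cardsE cardE size_filter enumT.
  by apply: eq_count => i /=; rewrite normr_eq0.
split.
  have [P [a [PP ME]]] := symmetric_spectral_theorem symM.
  have svM := singular_values_diag a PP; rewrite -ME in svM.
  rewrite (permP svM) countE => -[cardI svs].
  exists P, (s^-1 *: a), [set i | a 0 i != 0]; split => // [i|]; last first.
    by rewrite ME linearZ /= -scalemxAr -scalemxAl.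
  rewrite mxE normrM normfV (gtr0_norm s0) inE.
  have [->|aN0] := eqVneq (a 0 i) 0; first by rewrite normr0 mulr0.
  rewrite (svs `|a 0 i|) ?mulVf ?normr_eq0 //.
  by rewrite (perm_mem svM); apply/mapP; exists i; rewrite ?mem_enum.
move=> [P [e [I [PP cardI eI sM]]]].
have ME : M = P^T *m diag_mx (s *: e) *m P.
  rewrite linearZ /= -scalemxAr -scalemxAl -sM scalerA mulfV //.
  by rewrite scale1r.
have svM := singular_values_diag (s *: e) PP; rewrite -ME in svM.
split.
  rewrite (permP svM) countE -cardI; apply: eq_card => i.
  rewrite inE mxE mulf_eq0 (negPf sN0) /= -normr_eq0 eI.
  by case: (i \in I); rewrite ?oner_eq0 ?eqxx.
move=> x; rewrite (perm_mem svM) => /mapP[i _ ->].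
rewrite mxE normrM eI gtr0_norm //.
by case: (i \in I); rewrite ?mulr1 // mulr0 eqxx.
Qed.

(** * Sign matrices and graphs *)

Lemma row_sumE (R : pzRingType) n (M : 'M[R]_n) (s : R) : M^T = M ->
  (forall i, row_sum M i = s) <-> (const_mx 1 : 'rV_n) *m M = s *: const_mx 1.
Proof.
move=> symM; have rsE i : row_sum M i = ((const_mx 1 : 'rV_n) *m M) 0 i.
  rewrite mxE; apply: eq_bigr => j _.
  by rewrite -[in LHS]symM !mxE mul1r.
split=> [rs|rs i]; last by rewrite rsE rs !mxE mulr1.
by apply/rowP => i; rewrite -rsE rs !mxE mulr1.
Qed.

Lemma pm1_frobenius (R : comPzRingType) m n (M : 'M[R]_(m, n)) :
  pm1_mx M -> \tr (M *m M^T) = (m * n)%:R.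
Proof.
move=> M1; rewrite mxtrace_mul_trE.
rewrite (eq_bigr (fun=> n%:R)) => [|i _].
  by rewrite sumr_const card_ord -mulrnA mulnC.
rewrite (eq_bigr (fun=> 1)) => [|j _]; first by rewrite sumr_const card_ord.
by case: (M1 i j) => ->; rewrite ?mulrNN mulr1.
Qed.

Local Notation signed_adjmx R G := (2%:R *: adjmx R G - const_mx 1).

Lemma adjmx_sym (R : pzRingType) n (G : simple_graph n) :
  (adjmx R G)^T = adjmx R G.
Proof. by apply/matrixP => i j; rewrite !mxE adj_sym. Qed.

Lemma signed_adjmx_sym (R : rcfType) n (G : simple_graph n) :
  (signed_adjmx R G)^T = signed_adjmx R G.
Proof. by rewrite linearB linearZ /= adjmx_sym trmx_const. Qed.

Lemma signed_adjmx_pm1 (R : rcfType) n (G : simple_graph n) :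
  pm1_mx (signed_adjmx R G).
Proof.
move=> i j; rewrite !mxE; case: adj; first by right; rewrite mulr1; ring.
by left; rewrite mulr0 add0r.
Qed.

Lemma signed_adjmx_diag (R : rcfType) n (G : simple_graph n) (i : 'I_n) :
  (signed_adjmx R G) i i = -1.
Proof. by rewrite !mxE adj_irr mulr0 add0r. Qed.

(** The all-ones matrix is [u^T u] for the all-ones row [u], so its part of the
    trace is the quadratic form of [W] at [u]. *)
Lemma signed_adjmx_trace (R : rcfType) n (G : simple_graph n) (W : 'M[R]_n) :
  let u : 'rV_n := const_mx 1 in
  2 * \tr (adjmx R G *m W) =
    \tr (signed_adjmx R G *m W) + (u *m W *m u^T) 0 0.
Proof.
rewrite /= -mxtrace_row_form -raddfD -mulmxDl.
have -> : (const_mx 1 : 'rV[R]_n)^T *m (const_mx 1 : 'rV[R]_n) = const_mx 1.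
  by apply/matrixP => i j; rewrite !mxE big_ord1 !mxE mulr1.
by rewrite subrK -scalemxAl /= mxtraceZ.
Qed.

Theorem theorem3p6 (R : rcfType) (n k : nat) (hk : (2 <= k)%N) (hkn : (k <= n)%N)
    (G : simple_graph n) :
  graph_kyfan_norm R k G <= n%:R * Num.sqrt k%:R / 2%:R + n%:R / 2%:R /\
  (graph_kyfan_norm R k G = n%:R * Num.sqrt k%:R / 2%:R + n%:R / 2%:R <->
   let H : 'M[R]_n := 2%:R *: adjmx R G - const_mx 1 in
   let s : R := n%:R / Num.sqrt k%:R in
   regular_mx H /\
   H \is symmetricmx /\
   pm1_mx H /\
   (forall i, H i i = -1) /\
   (forall i, row_sum H i = s) /\
   count (fun x => x != 0) (singular_values H) = k /\
   (forall x, x \in singular_values H -> x != 0 -> x = s)).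
Proof.
rewrite /graph_kyfan_norm; set r : R := Num.sqrt k%:R; set s := n%:R / r.
set A := adjmx R G; set H := 2%:R *: A - const_mx 1.
pose u : 'rV[R]_n := const_mx 1.
have symH : H^T = H by exact: signed_adjmx_sym.
have r_gt0 : 0 < r by rewrite sqrtr_gt0 ltr0n ltnW.
have r2 : r ^+ 2 = k%:R by rewrite sqr_sqrtr.
have s_gt0 : 0 < s by rewrite divr_gt0 // ltr0n (leq_trans _ hkn) // ltnW.
have sk : s * k%:R = n%:R * r by rewrite -r2 /s; field; rewrite gt_eqF.
have HH : \tr (H *m H^T) = s * (s * k%:R).
  rewrite pm1_frobenius; last exact: signed_adjmx_pm1.
  by rewrite sk natrM /s; field; rewrite gt_eqF.
have uu : (u *m u^T) 0 0 = n%:R.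
  rewrite mxE (eq_bigr (fun=> 1)) => [|i _]; last by rewrite !mxE mulr1.
  by rewrite sumr_const card_ord.
have [W WP WA] := kyfan_norm_attained (adjmx_sym R G) hkn.
have kyE := signed_adjmx_trace G W; rewrite /= -/A -/H -/u WA in kyE.
(* Cauchy-Schwarz applies with the ratio [s] because both [H] and [s *: W] have
   squared Frobenius norm [n^2 = s^2 k]. *)
have := @frobenius_cauchy_schwarz _ _ _ H W s s_gt0.
rewrite (partial_reflection_frobenius WP) (partial_reflection_sym WP).
rewrite expr2 -mulrA HH sk => /(_ erefl)[leH eqH].
have [leu equ] := partial_reflection_form u WP; rewrite uu in leu equ.
have ky_le : kyfan_norm k A <= n%:R * r / 2 + n%:R / 2 by lra.
split=> //; split.
  move=> kyA; have HW : H = s *: W by apply: eqH; lra.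
  have uW : u *m W = u by apply: equ; lra.
  have rs : forall i, row_sum H i = s.
    by apply/row_sumE => //; rewrite HW -scalemxAr uW.
  have /flat_singular_valuesP[//|//|cnt svs] : partial_reflection k (s^-1 *: H).
    by rewrite HW scalerA mulVf ?scale1r ?gt_eqF.
  have cs j : col_sum H j = s.
    by rewrite -(rs j); apply: eq_bigr => i _; rewrite -[in LHS]symH mxE.
  split; first by split=> i j; rewrite ?rs ?cs.
  split; first by rewrite is_hermitianmxE expr0 scale1r map_mx_id // symH.
  split; first exact: signed_adjmx_pm1.
  by split; first exact: signed_adjmx_diag.
move=> [_ [_ [_ [_ [rs flat]]]]]; apply/le_anti/andP; split=> //.
have VP : partial_reflection k (s^-1 *: H) by exact/flat_singular_valuesP.
apply: le_trans (kyfan_norm_ge (adjmx_sym R G) hkn VP).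
have := signed_adjmx_trace G (s^-1 *: H); rewrite /= -/A -/H -/u.
have /(row_sumE _ symH) uH := rs.
rewrite -!scalemxAr uH scalerA mulVf ?gt_eqF // scale1r uu !mxtraceZ.
move: HH; rewrite symH => ->.
rewrite mulKf ?gt_eqF // sk => VE; lra.
Qed.
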